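(* Let $\Gamma$ be a finite connected graph without loops, with a Hamiltonian $\mathcal H$ and associated Lagrangian $\mathcal L$. Let $c\in H^1(\Gamma,\mathbb R)$ and $h\in H_1(\Gamma,\mathbb R)$. (i) If $(f,q_1),(f,q_2)\in\widetilde{\mathcal M}_c$ (resp. $\widetilde{\mathcal M}^h$) for some $f\in E$, then $q_1=q_2$. (ii) If $(f,q_1),(-f,q_2)\in\widetilde{\mathcal M}_c$ (resp. $\widetilde{\mathcal M}^h$) for some $f\in E$, then $q_1=q_2=0$ and $\alpha(c)=\min\alpha$.
   Context: Graph. $\Gamma=(V,E)$ consists of disjoint finite sets $V$ (vertices) and $E\neq\emptyset$ (directed edges), a map $o:E\to V$ (origin) and a fixed-point-free involution $e\mapsto -e$ of $E$; $t(e):=o(-e)$. A path is a finite sequence of edges $(e_i)_{i=1}^M$ with $t(e_i)=o(e_{i+1})$. $\Gamma$ is connected (any two vertices are linked by a path) and has no loops ($o(e)\ne t(e)$ for every $e$). (Co)homology. $C_0$ is the real vector space with basis $V$; $C_1$ is the real vector space generated by $E$ with the edge $-e$ identified with the opposite of $e$; $\partial e=t(e)-o(e)$; $H_1(\Gamma,\mathbb R)=\ker\partial\subset C_1$. $C^0$ = functions $V\to\mathbb R$; $C^1$ = functions $\omega:E\to\mathbb R$ with $\omega(-e)=-\omega(e)$; $dg(e)=g(t(e))-g(o(e))$; $H^1(\Gamma,\mathbb R)=C^1/dC^0$. The pairing $\langle\omega,e\rangle=\omega(e)$ extends linearly to $C^1\times C_1$ and descends to $H^1\times H_1$. Tangent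 bundle and measures. $T\Gamma=(E\times[0,+\infty))/\sim$, where $(e,0)\sim(-e,0)$; $\mathbb R^+_e:=\{e\}\times[0,+\infty)$. The metric is $d((e_1,q_1),(e_2,q_2))=q_1+q_2+1$ if $e_1\ne\pm e_2$, $|q_1-q_2|$ if $e_1=e_2$, $q_1+q_2$ if $e_1=-e_2$. $\mathbb P$ is the set of Borel probability measures on $T\Gamma$ with $\int q\,d\mu<+\infty$, with the first Wasserstein distance. For $\mu\in\mathbb P$, $\rho(\mu)=\sum_{e\in E}\big(\int_{\mathbb R^+_e}q\,d\mu\big)e\in C_1$ and, for $\omega\in C^1$, $\int\omega\,d\mu:=\langle\omega,\rho(\mu)\rangle$. $\mu$ is closed if $\int dg\,d\mu=0$ for all $g\in C^0$, equivalently $\rho(\mu)\in H_1(\Gamma,\mathbb R)$ (the rotation vector of $\mu$); $\mathbb M\subset\mathbb P$ is the set of closed measures. Hamiltonian and Lagrangian. A Hamiltonian is a family $\mathcal H(e,\cdot):\mathbb R\to\mathbb R$, $e\in E$, with $\mathcal H(e,p)=\mathcal H(-e,-p)$, each strictly convex, differentiable and superlinear ($\mathcal H(e,p)/|p|\to+\infty$ as $p\to\pm\infty$). The Lagrangian is $\mathcal L(e,q)=\max_{p\in\mathbb R}(pq-\mathcal H(e,p))$, well defined on $T\Gamma$; for $\omega\in C^1$, $\mathcal L^\omega(e,q)=\mathcal L(e,q)-q\,\omega(e)$. Mather theory. $\beta(h)=\min\{\int\mathcal L\,d\mu:\mu\in\mathbb M,\ \rho(\mu)=h\}$ for $h\in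 H_1(\Gamma,\mathbb R)$; $\alpha(c)=\max_{h}(\langle c,h\rangle-\beta(h))=-\min_{\mu\in\mathbb M}\int\mathcal L^\omega d\mu$ for $c\in H^1(\Gamma,\mathbb R)$, with $\omega$ any representative of $c$; $\min\alpha$ is the minimum of $\alpha$ over $H^1(\Gamma,\mathbb R)$. $\mathbb M^h$ is the set of $\mu\in\mathbb M$ with $\rho(\mu)=h$ and $\int\mathcal L\,d\mu=\beta(h)$; $\mathbb M_c$ is the set of $\mu\in\mathbb M$ with $\int\mathcal L^\omega d\mu=-\alpha(c)$. The Mather sets are $\widetilde{\mathcal M}^h=\bigcup_{\mu\in\mathbb M^h}\operatorname{supp}\mu$ and $\widetilde{\mathcal M}_c=\bigcup_{\mu\in\mathbb M_c}\operatorname{supp}\mu$, subsets of $T\Gamma$ (supp is the topological support).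
   Formalization: In (ii) for the Mather set of h, the equality α(c)=min α is asserted only for c in the subdifferential of β at h; for unrelated c and h it is false (two vertices joined by two edges, H=p²/2, h=0, c≠0). *)

(* Defs.v *)
From HB Require Import structures.
From mathcomp Require Import all_boot all_order all_algebra.
From mathcomp Require Import all_classical all_reals all_analysis.
From mathcomp Require Import ring lra.
From mathcomp Require generic_quotient ring_quotient.
Import generic_quotient ring_quotient.

Set Implicit Arguments.
Unset Strict Implicit.
Unset Printing Implicit Defensive.

Import Order.TTheory GRing.Theory Num.Theory.
Import numFieldNormedType.Exports.

Local Open Scope classical_set_scope.
Local Open Scope ring_scope.
Local Open Scope quotient_scope.

Record graph := Graph {
  vertex : finType;
  edge : finType;
  edge_gt0 : (0 < #|edge|)%N;
  origin : edge -> vertex;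
  opposite : edge -> edge;
  oppositeK : involutive opposite;
  opposite_neq : forall e, opposite e != e }.

Definition terminus (G : graph) (e : edge G) : vertex G := origin (opposite e).

(* [e :: p] is a sequence of edges, each ending where the next one starts. *)
Definition is_path (G : graph) (e : edge G) (p : seq (edge G)) : bool :=
  path (fun e1 e2 => terminus e1 == origin e2) e p.

Definition graph_connected (G : graph) : Prop :=
  forall x y : vertex G, exists (e : edge G) (p : seq (edge G)),
    [/\ is_path e p, origin e = x & terminus (last e p) = y].

Definition loopless (G : graph) : Prop :=
  forall e : edge G, origin e != terminus e.

Section chains.
Variables (G : graph) (R : realType).

(* C_1 is the space R^E of formal combinations of edges modulo the span of the
   e + (-e); this span consists of the coefficient families invariant under
   reversal. *)
Definition reversal_invariant : {pred {ffun edge G -> R}} :=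
  fun a : {ffun edge G -> R} => [forall e, a (opposite e) == a e].

Lemma reversal_invariant_zmod : zmod_closed reversal_invariant.
Proof.
split; first by apply/forallP => e; rewrite !ffunE.
move=> a b /forallP aP /forallP bP; apply/forallP => e.
by rewrite !ffunE (eqP (aP e)) (eqP (bP e)).
Qed.

HB.instance Definition _ :=
  GRing.isZmodClosed.Build {ffun edge G -> R} reversal_invariant
    reversal_invariant_zmod.

Definition chain1 : Type :=
  @Quotient.quot {ffun edge G -> R} reversal_invariant.
HB.instance Definition _ := ZmodQuotient.on chain1.

Definition chain_of (a : edge G -> R) : chain1 :=
  \pi_chain1 [ffun e => a e].

(* Coefficients of some expression of a chain as a combination of edges. *)
Definition coef (x : chain1) : {ffun edge G -> R} := repr x.

Definition boundary (x : chain1) : {ffun vertex G -> R} :=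
  [ffun v => \sum_e coef x e * ((terminus e == v)%:R - (origin e == v)%:R)].

Definition homology1 : set chain1 := [set x | boundary x = 0].

Definition antisymmetric_edge : {pred {ffun edge G -> R}} :=
  fun w : {ffun edge G -> R} => [forall e, w (opposite e) == - w e].

Lemma antisymmetric_edge_zmod : zmod_closed antisymmetric_edge.
Proof.
split; first by apply/forallP => e; rewrite !ffunE oppr0.
move=> a b /forallP aP /forallP bP; apply/forallP => e.
by rewrite !ffunE (eqP (aP e)) (eqP (bP e)) opprD.
Qed.

HB.instance Definition _ :=
  GRing.isZmodClosed.Build {ffun edge G -> R} antisymmetric_edge
    antisymmetric_edge_zmod.

Record cochain1 := Cochain1 {
  cochain_val :> {ffun edge G -> R};
  cochain_antisym : cochain_val \in antisymmetric_edge }.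

HB.instance Definition _ := [isSub for cochain_val].
HB.instance Definition _ := [Choice of cochain1 by <:].
HB.instance Definition _ := [SubChoice_isSubZmodule of cochain1 by <:].

Lemma coboundary_antisym (g : {ffun vertex G -> R}) :
  [ffun e => g (terminus e) - g (origin e)] \in antisymmetric_edge.
Proof. by apply/forallP => e; rewrite !ffunE /terminus oppositeK opprB. Qed.

Definition coboundary (g : {ffun vertex G -> R}) : cochain1 :=
  Cochain1 (coboundary_antisym g).

Definition exact1 : {pred cochain1} :=
  fun w : cochain1 => `[< exists g, w = coboundary g >].

Lemma exact1_zmod : zmod_closed exact1.
Proof.
split.
  apply/asboolP; exists 0; apply/val_inj/ffunP => e /=.
  by rewrite !ffunE subrr.
move=> _ _ /asboolP[g ->] /asboolP[k ->]; apply/asboolP; exists (g - k).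
by apply/val_inj/ffunP => e /=; rewrite !ffunE; ring.
Qed.

HB.instance Definition _ :=
  GRing.isZmodClosed.Build cochain1 exact1 exact1_zmod.

Definition cohomology1 : Type := @Quotient.quot cochain1 exact1.
HB.instance Definition _ := ZmodQuotient.on cohomology1.

Definition cohom_class (w : cochain1) : cohomology1 := \pi_cohomology1 w.
Definition cohom_repr (c : cohomology1) : cochain1 := repr c.

Definition pairing (w : cochain1) (x : chain1) : R := \sum_e coef x e * w e.

Lemma sum_invariant_antisym (a : {ffun edge G -> R}) (w : cochain1) :
  a \in reversal_invariant -> \sum_e a e * w e = 0.
Proof.
move=> /forallP aP; set s := \sum_e _.
suff: s = - s by move=> ?; lra.
rewrite {1}/s (reindex_inj (inv_inj (@oppositeK G))) -sumrN.
apply: eq_bigr => e _.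
by rewrite (eqP (aP e)) (eqP (forallP (cochain_antisym w) e)) mulrN.
Qed.

Lemma pairing_chain_of (w : cochain1) (a : edge G -> R) :
  pairing w (chain_of a) = \sum_e a e * w e.
Proof.
apply/eqP; rewrite -subr_eq0 -sumrB; apply/eqP.
have : coef (chain_of a) - [ffun e => a e] \in reversal_invariant.
  by rewrite Quotient.idealrBE /coef reprK.
move=> /(@sum_invariant_antisym _ w) E; rewrite -[RHS]E; apply: eq_bigr => e _.
by rewrite !ffunE mulrBl.
Qed.

Lemma boundary_chain_of (a : edge G -> R) :
  boundary (chain_of a) =
  [ffun v => \sum_e a e * ((terminus e == v)%:R - (origin e == v)%:R)].
Proof.
apply/ffunP => v; rewrite !ffunE.
have E (x : chain1) :
    \sum_e coef x e * ((terminus e == v)%:R - (origin e == v)%:R) =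
    pairing (coboundary [ffun u => (u == v)%:R]) x.
  by apply: eq_bigr => e _; rewrite /= !ffunE.
by rewrite E pairing_chain_of; apply: eq_bigr => e _; rewrite /= !ffunE.
Qed.

Definition pairing_cohom (c : cohomology1) (h : chain1) : R :=
  pairing (cohom_repr c) h.

Lemma pairing_coboundary (g : {ffun vertex G -> R}) (x : chain1) :
  pairing (coboundary g) x = \sum_v g v * boundary x v.
Proof.
under [RHS]eq_bigr do rewrite ffunE mulr_sumr.
rewrite exchange_big /=; apply: eq_bigr => e _; rewrite ffunE.
have E (u : vertex G) : \sum_v g v * (u == v)%:R = g u.
  rewrite (bigD1 u) //= eqxx mulr1 big1 ?addr0 // => i /negPf iu.
  by rewrite eq_sym iu mulr0.
rewrite -(E (terminus e)) -(E (origin e)) -sumrB mulr_sumr.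
by apply: eq_bigr => v _; ring.
Qed.

Lemma pairing_cohom_class (w : cochain1) (h : chain1) :
  homology1 h -> pairing_cohom (cohom_class w) h = pairing w h.
Proof.
move=> h0; apply/eqP; rewrite -subr_eq0; apply/eqP.
have : cohom_repr (cohom_class w) - w \in exact1.
  by rewrite Quotient.idealrBE /cohom_repr reprK.
move=> /asboolP[g E].
have := pairing_coboundary g h; rewrite -E h0 [RHS]big1 => [<-|v _]; last first.
  by rewrite ffunE mulr0.
by rewrite -sumrB; apply: eq_bigr => e _; rewrite -mulrBr !ffunE.
Qed.

End chains.

Section tangent.
Variables (G : graph) (R : realType).

Let pretangent : Type := (edge G * {nonneg R})%type.

Definition glue (x y : pretangent) : bool :=
  (x == y) || [&& y.1 == opposite x.1, x.2%:num == 0 & y.2%:num == 0].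

Lemma glue_refl : reflexive glue.
Proof. by move=> x; rewrite /glue eqxx. Qed.

Lemma eq_opposite_sym (e f : edge G) : (e == opposite f) = (f == opposite e).
Proof. by rewrite -(can_eq (@oppositeK G)) oppositeK eq_sym. Qed.

Lemma glue_sym : symmetric glue.
Proof.
move=> x y; rewrite /glue eq_sym eq_opposite_sym; congr (_ || _).
by rewrite (andbC (_ == 0)).
Qed.

Lemma glue_trans : transitive glue.
Proof.
move=> y x z; rewrite /glue => /orP[/eqP-> //|/and3P[/eqP yx x0 y0]].
move=> /orP[/eqP<-|/and3P[/eqP zy _ z0]]; first by rewrite yx x0 y0 eqxx orbT.
apply/orP; left; apply/eqP.
case: x z yx zy x0 z0 => [e q] [f r] /= yx zy /eqP q0 /eqP r0.
by rewrite zy yx oppositeK; congr (_, _); apply/val_inj; rewrite /= q0 r0.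
Qed.

Canonical glue_equiv := EquivRel glue glue_refl glue_sym glue_trans.

Definition tangent : Type := {eq_quot glue_equiv}.
HB.instance Definition _ := Choice.on tangent.

Definition tpoint (e : edge G) (q : {nonneg R}) : tangent :=
  \pi_{eq_quot glue_equiv} (e, q).

(* For a point (e, 0) = (-e, 0), [tedge] is one of e and -e. *)
Definition tedge (x : tangent) : edge G := (repr x).1.
Definition tspeed (x : tangent) : R := (repr x).2%:num.

Definition ray (e : edge G) : set tangent := range (tpoint e).

Lemma tpointE (x : tangent) : x = tpoint (tedge x) (repr x).2.
Proof. by rewrite /tpoint -surjective_pairing reprK. Qed.

Lemma tpoint_repr e q :
  (tedge (tpoint e q) = e /\ tspeed (tpoint e q) = q%:num) \/
  [/\ tedge (tpoint e q) = opposite e, tspeed (tpoint e q) = 0 & q%:num = 0].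
Proof.
have /eqmodP/orP[/eqP E|/and3P[/eqP E /eqP E1 /eqP E2]] :
  (e, q) = repr (tpoint e q) %[mod {eq_quot glue_equiv}] by rewrite reprK.
- by left; rewrite /tedge /tspeed -E.
- by right; split.
Qed.

Lemma tspeed_tpoint e q : tspeed (tpoint e q) = q%:num.
Proof. by have [[]|[_ -> ->]] := tpoint_repr e q. Qed.

Definition tdist (x y : tangent) : R :=
  if tedge x == tedge y then `|tspeed x - tspeed y|
  else if tedge x == opposite (tedge y) then tspeed x + tspeed y
  else tspeed x + tspeed y + 1.

Lemma tspeed_ge0 x : 0 <= tspeed x.
Proof. by rewrite /tspeed. Qed.

Lemma opposite_neqF (e : edge G) : (e == opposite e) = false.
Proof. by rewrite eq_sym; apply/negbTE/opposite_neq. Qed.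

Lemma tdist_tpoint e1 (q1 : {nonneg R}) e2 (q2 : {nonneg R}) :
  tdist (tpoint e1 q1) (tpoint e2 q2) =
  if e1 == e2 then `|q1%:num - q2%:num|
  else if e1 == opposite e2 then q1%:num + q2%:num
  else q1%:num + q2%:num + 1.
Proof.
rewrite /tdist !tspeed_tpoint.
have [[-> _]|[-> _ q10]] := tpoint_repr e1 q1;
  have [[-> _]|[-> _ q20]] := tpoint_repr e2 q2.
- by [].
- rewrite oppositeK q20 addr0 subr0 ger0_norm //.
  by have [->|_] := eqVneq e1 e2; rewrite ?opposite_neqF.
- rewrite q10 (can_eq (@oppositeK G)) !add0r normrN ger0_norm //.
  have -> : (opposite e1 == e2) = (e1 == opposite e2).
    by rewrite eq_sym eq_opposite_sym.
  by have [->|_] := eqVneq e1 e2; rewrite ?opposite_neqF.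
- by rewrite q10 q20 !(can_eq (@oppositeK G)).
Qed.

Lemma tdistxx x : tdist x x = 0.
Proof. by rewrite /tdist eqxx subrr normr0. Qed.

Lemma tdist_eq0 x y : tdist x y = 0 -> x = y.
Proof.
rewrite (tpointE x) (tpointE y) tdist_tpoint.
case: eqP => [->|_] => [/normr0_eq0/eqP|].
  by rewrite subr_eq0 => /eqP E; congr tpoint; apply/val_inj.
have ? : 0 <= (repr x).2%:num by [].
have ? : 0 <= (repr y).2%:num by [].
case: eqP => [E h|_]; last by move=> h; exfalso; lra.
apply/eqmodP/orP; right; rewrite /= E oppositeK eqxx /=.
by apply/andP; split; apply/eqP; lra.
Qed.

Lemma tdist_sym x y : tdist x y = tdist y x.
Proof.
by rewrite /tdist eq_sym distrC eq_opposite_sym (addrC (tspeed x)).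
Qed.

Lemma tdist_triangle y x z : tdist x z <= tdist x y + tdist y z.
Proof.
rewrite /tdist.
have := tspeed_ge0 x; have := tspeed_ge0 y; have := tspeed_ge0 z.
move: (tspeed x) (tspeed y) (tspeed z) => a b c c0 b0 a0.
have tri1 : `|a - c| <= `|a - b| + `|b - c| by rewrite ler_distD.
have tri2 : a <= `|a - b| + b by have := ler_norm (a - b); lra.
have tri3 : c <= b + `|b - c| by have := ler_norm (c - b); rewrite distrC; lra.
have tri4 : `|a - c| <= a + c by rewrite ler_norml; apply/andP; split; lra.
have [->|xy] := eqVneq (tedge x) (tedge y).
  by case: ifP => _; [|case: ifP => _]; lra.
have [<-|yz] := eqVneq (tedge y) (tedge z).
  by rewrite (negbTE xy); case: ifP => _; lra.
have [->|xry] := eqVneq (tedge x) (opposite (tedge y)).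
  have [_|ryz] := eqVneq (opposite (tedge y)) (tedge z); first by
    case: ifP => _; lra.
  have -> : (tedge y == opposite (tedge z)) = false.
    by rewrite eq_opposite_sym eq_sym; apply/negbTE.
  by case: ifP => _; lra.
by do ![case: ifP => _]; lra.
Qed.

HB.instance Definition _ := @isMetric.Build R tangent
  tdist tdistxx tdist_eq0 tdist_sym tdist_triangle.

HB.instance Definition _ :=
  isPointed.Build tangent (tpoint (enum_val (Ordinal (edge_gt0 G))) 0%:nng).

Definition tborel := g_sigma_algebraType (@open tangent).

End tangent.

Section measures.
Variables (G : graph) (R : realType).
Local Notation bprob := (probability (tborel G R) R).
Implicit Type mu : bprob.

Definition msupport mu : set (tangent G R) :=
  [set x | forall U : set (tangent G R), open U -> U x -> (0 < mu U)%E].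

Definition finite_moment_measures : set bprob :=
  [set mu : bprob | (\int[mu]_x (tspeed x)%:E < +oo)%E].

Definition rho mu : chain1 G R :=
  chain_of (fun e => fine (\int[mu]_(x in ray e) (tspeed x)%:E)%E).

Definition int_cochain mu (w : cochain1 G R) : R := pairing w (rho mu).

Definition closed_measures : set bprob :=
  [set mu : bprob |
    finite_moment_measures mu /\ forall g, int_cochain mu (coboundary g) = 0].

End measures.

Record hamiltonian (G : graph) (R : realType) (H : edge G -> R -> R) : Prop := {
  ham_opposite : forall e p, H e p = H (opposite e) (- p);
  ham_strictly_convex : forall e p1 p2 t, p1 != p2 -> 0 < t < 1 ->
    H e (t * p1 + (1 - t) * p2) < t * H e p1 + (1 - t) * H e p2;
  ham_derivable : forall e p, derivable (H e) p 1;
  ham_superlinear_pinfty : forall e, H e p / `|p| @[p --> +oo] --> +oo;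
  ham_superlinear_ninfty : forall e, H e p / `|p| @[p --> -oo] --> +oo }.

Section mather.
Variables (G : graph) (R : realType) (H : edge G -> R -> R).
Local Notation bprob := (probability (tborel G R) R).
Implicit Type mu : bprob.

(* For a Hamiltonian this supremum is a maximum. *)
Definition lagrangian_edge (e : edge G) (q : R) : R :=
  sup [set p * q - H e p | p in [set: R]].

Definition lagrangian (x : tangent G R) : R :=
  lagrangian_edge (tedge x) (tspeed x).

Lemma lagrangian_tpoint (Hham : hamiltonian H) e (q : {nonneg R}) :
  lagrangian (tpoint e q) = lagrangian_edge e q%:num.
Proof.
rewrite /lagrangian tspeed_tpoint.
have [[-> //]|[-> _ ->]] := tpoint_repr e q.
congr sup; apply/seteqP; split => _ [p _ <-]; exists (- p) => //;
  by rewrite !mulr0 (ham_opposite Hham e) ?opprK.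
Qed.

Definition twisted_lagrangian (w : cochain1 G R) (x : tangent G R) : R :=
  lagrangian x - tspeed x * w (tedge x).

Definition action mu : \bar R := (\int[mu]_x (lagrangian x)%:E)%E.

Definition twisted_action (w : cochain1 G R) mu : \bar R :=
  (\int[mu]_x (twisted_lagrangian w x)%:E)%E.

(* Under the standing assumptions (a Hamiltonian on a connected graph, h in
   [homology1]) all the infima and suprema below are attained, and [beta] and
   [alpha] take finite values. *)
Definition beta (h : chain1 G R) : \bar R :=
  ereal_inf [set action mu | mu in
    [set mu : bprob | closed_measures mu /\ rho mu = h]].

Definition alpha (c : cohomology1 G R) : \bar R :=
  ereal_sup [set ((pairing_cohom c h)%:E - beta h)%E | h in @homology1 G R].

Definition min_alpha : \bar R := ereal_inf (range alpha).

Definition measures_rot (h : chain1 G R) : set bprob :=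
  [set mu : bprob |
    [/\ closed_measures mu, rho mu = h & action mu = beta h]].

Definition measures_coh (c : cohomology1 G R) : set bprob :=
  [set mu : bprob |
    closed_measures mu /\ twisted_action (cohom_repr c) mu = (- alpha c)%E].

Definition mather_rot (h : chain1 G R) : set (tangent G R) :=
  \bigcup_(mu in measures_rot h) msupport mu.

Definition mather_coh (c : cohomology1 G R) : set (tangent G R) :=
  \bigcup_(mu in measures_coh c) msupport mu.

Definition in_subdifferential_beta (h : chain1 G R) (c : cohomology1 G R) : Prop :=
  forall h', @homology1 G R h' ->
    (beta h + (pairing_cohom c h' - pairing_cohom c h)%:E <= beta h')%E.

End mather.

(* Main.v *)
(* The rays of [f] and [- f] form a line on which the Lagrangian is a strictly
   convex function of the signed speed, because the Hamiltonian is
   differentiable.  Replacing a measure by Dirac masses at its mean signed speed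
   on each line keeps the rotation vector and, by Jensen's inequality, strictly
   decreases the action unless the speed is almost everywhere constant on each
   line.  Averaging two minimizers in this way shows that all of them charge one
   and the same point of each line, which must be the origin if both rays of the
   line are met.  In that case the Dirac mass at the origin is a closed measure
   of rotation vector 0; taking a bit of it out of the minimizer and rescaling
   gives a competitor which shows that its action L(f, 0) is at most
   [- alpha c], whereas [alpha c' >= - L(f, 0)] for every [c']. *)

From HB Require Import structures.
Require Import Defs.
From mathcomp Require Import all_boot all_order all_algebra.
From mathcomp Require Import all_classical all_reals all_analysis.
From mathcomp Require Import measurable_realfun ring lra.
From mathcomp Require Import generic_quotient ring_quotient.

Set Implicit Arguments.
Unset Strict Implicit.
Unset Printing Implicit Defensive.

Import Order.TTheory GRing.Theory Num.Theory.
Import numFieldNormedType.Exports.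

Local Open Scope classical_set_scope.
Local Open Scope ring_scope.

(** * Legendre transform *)

Section legendre.
Variables (R : realType) (h : R -> R).
Hypothesis h_derivable : forall p, derivable h p 1.
Hypothesis h_pinfty : h p / `|p| @[p --> +oo] --> +oo.
Hypothesis h_ninfty : h p / `|p| @[p --> -oo] --> +oo.

Definition legendre (q : R) : R := sup [set p * q - h p | p in [set: R]].

Lemma superlinear_growth (A : R) :
  exists2 M, 0 < M & forall p, M < `|p| -> A * `|p| <= h p.
Proof.
have /cvgryPge/(_ A)[M1 [_ hM1]] := h_pinfty.
have /cvgryPge/(_ A)[M2 [_ hM2]] := h_ninfty.
(* This exceeds both [M1] and [- M2], and its positivity keeps [|p|] away from 0 for the
   division. *)
exists (1 + `|M1| + `|M2|) => [|p pM].
  by rewrite -addrA ltr_pwDl// addr_ge0.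
have p0 : 0 < `|p| by apply: le_lt_trans pM; rewrite !addr_ge0.
rewrite -ler_pdivlMr//.
have := ler_norm M1; have := ler_norm (- M2); rewrite normrN => N2 N1.
have [pge|plt] := lerP 0 p.
  by apply: hM1; move: pM; rewrite (ger0_norm pge); have := normr_ge0 M2; lra.
by apply: hM2; move: pM; rewrite (ltr0_norm plt); have := normr_ge0 M1; lra.
Qed.

(** Superlinear growth confines the maximization to a compact interval, where the extreme value
    theorem applies. *)
Lemma legendre_maximizer (q : R) :
  exists p, forall p', p' * q - h p' <= p * q - h p.
Proof.
(* The term [|q|] absorbs [p' * q]; the rest, [|h 0| * |p'|], dominates [h 0] once [|p'|] is at
   least 1, which the radius [N = M + 1] ensures outside the interval. *)
have [M M0 hM] := superlinear_growth (`|q| + `|h 0|).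
pose N := M + 1.
have cg : {within `[- N, N], continuous (fun p => h p - p * q)}.
  apply: derivable_within_continuous => p _.
  apply: derivableB; first exact: h_derivable.
  by apply: derivableM => //; exact: derivable_cst.
have [|p _ pmin] := EVT_min _ cg; first by rewrite /N; lra.
exists p => p'.
suff : h p - p * q <= h p' - p' * q by lra.
have [p'N|Np'] := lerP `|p'| N.
  by apply: pmin; rewrite in_itv /= -ler_norml.
apply: (@le_trans _ _ (h 0 - 0 * q)).
  by apply: pmin; rewrite in_itv /=; apply/andP; split; rewrite /N; lra.
rewrite /N in Np'; have Mp' : M < `|p'| by lra.
have := hM _ Mp'.
have pq : p' * q <= `|q| * `|p'| by rewrite mulrC -normrM ler_norm.
have h0 : h 0 <= `|h 0| by exact: ler_norm.
have : `|h 0| <= `|h 0| * `|p'| by rewrite ler_peMr //; lra.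
lra.
Qed.

Lemma legendre_ub p q : p * q - h p <= legendre q.
Proof.
apply: ub_le_sup; last by exists p.
have [p0 max0] := legendre_maximizer q.
by exists (p0 * q - h p0) => _ [p' _ <-].
Qed.

Lemma legendre_attained q : exists p,
  (forall p', p' * q - h p' <= p * q - h p) /\ legendre q = p * q - h p.
Proof.
have [p pmax] := legendre_maximizer q; exists p; split=> //.
apply/le_anti; rewrite legendre_ub andbT ge_sup //.
  by exists (p * q - h p), p.
by move=> _ [p' _ <-].
Qed.

(** First-order condition for [p * q - h p] at an interior maximum. *)
Lemma maximizer_derive q p :
  (forall p', p' * q - h p' <= p * q - h p) -> derive1 h p = q.
Proof.
move=> pmax.
have dg (t : R) : derivable (fun p : R => p * q - h p) t 1.
  apply: derivableB; last exact: h_derivable.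
  by apply: derivableM => //; exact: derivable_cst.
have [_ g0] : is_derive p 1 (fun p : R => p * q - h p) 0.
  apply: (@derive1_at_max _ _ (p - 1) (p + 1)) => //; first by lra.
  by rewrite in_itv /=; apply/andP; split; lra.
have E : is_derive p 1 (fun p : R => p * q - h p) (q - derive1 h p).
  rewrite derive1E; apply: is_deriveB.
    by apply: is_derive_eq; rewrite /= scaler0 add0r /GRing.scale /= mulr1.
  exact/derivableP/h_derivable.
by have [_] := E; rewrite g0 => /eqP; rewrite eq_sym subr_eq0 => /eqP.
Qed.

(* A slope common to two points would have to equal the derivative of [h] at
   two distinct values. *)
Lemma legendre_strict_subgradient t :
  exists p, forall s, s != t -> legendre t + p * (s - t) < legendre s.
Proof.
have [p [pmax pE]] := legendre_attained t; exists p => s st.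
have -> : legendre t + p * (s - t) = p * s - h p by rewrite pE; ring.
rewrite lt_neqAle legendre_ub andbT; apply: contra_neq st => sE.
rewrite -(maximizer_derive pmax); apply/esym/maximizer_derive => p'.
by rewrite sE legendre_ub.
Qed.

(** A supremum of affine functions is lower semicontinuous: its strict superlevel sets are unions of
    open sets. *)
Lemma measurable_legendre : measurable_fun setT legendre.
Proof.
apply: (measurability _ (RGenOInfty.measurableE R)) => _ [_ [a ->] <-].
apply: measurableI => //; apply: open_measurable.
have -> : legendre @^-1` `]a, +oo[ =
    \bigcup_p ((fun q : R => p * q - h p) @^-1` `]a, +oo[).
  apply/seteqP; split => q /=; rewrite in_itv /= andbT.
    have [p [_ ->]] := legendre_attained q; exists p => //=.
    by rewrite in_itv /= andbT.
  move=> [p _ /=]; rewrite in_itv /= andbT => /lt_le_trans; apply.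
  exact: legendre_ub.
apply: bigcup_open => p _; apply: open_comp => [q _|]; last exact: interval_open.
apply: cvgB; last exact: cvg_cst.
by apply: cvgM; [exact: cvg_cst|exact: cvg_id].
Qed.

End legendre.

(** * Lines of the tangent bundle *)

Section tangent_functions.
Variables (G : graph) (R : realType).
Implicit Types (e f : edge G) (x y : tangent G R).

Lemma opposite_sym e f : (opposite e == f) = (e == opposite f).
Proof. by rewrite eq_sym eq_opposite_sym. Qed.

(* The line of [f] is the union of the rays of [f] and [- f], which meet at
   speed 0. *)
Definition in_line f x : bool := (tedge x == f) || (tedge x == opposite f).

Definition line_ind f x : R := (in_line f x)%:R.

(** Signed coordinate on the line of [f], positive along [f]. At the origin of the line both
    possible values of [tedge] give 0. The value is also 0 off the line, so [line_ind] is needed to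
    tell the two cases apart. *)
Definition sspeed f x : R :=
  if tedge x == f then tspeed x
  else if tedge x == opposite f then - tspeed x else 0.

(** Inverse of the signed coordinate on the line of [f]. *)
Definition spoint f (s : R) : tangent G R :=
  if 0 <= s then tpoint f (`|s|)%:nng else tpoint (opposite f) (`|s|)%:nng.

Lemma sspeed_tedge f x : tedge x = f -> sspeed f x = tspeed x.
Proof. by move=> <-; rewrite /sspeed eqxx. Qed.

Lemma sspeed_opposite f x : sspeed (opposite f) x = - sspeed f x.
Proof.
rewrite /sspeed oppositeK; case: eqP => [->|_]; first last.
  by case: eqP => // _; rewrite oppr0.
by rewrite (negbTE (opposite_neq f)) opprK.
Qed.

Lemma in_line_opposite f x : in_line (opposite f) x = in_line f x.
Proof. by rewrite /in_line oppositeK orbC. Qed.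

Lemma sspeed_out f x : ~~ in_line f x -> sspeed f x = 0.
Proof. by rewrite negb_or /sspeed => /andP[/negbTE-> /negbTE->]. Qed.

Lemma sspeed_abs f x : `|sspeed f x| = line_ind f x * tspeed x.
Proof.
rewrite /sspeed /line_ind /in_line.
case: eqP => _ /=; first by rewrite mul1r ger0_norm // tspeed_ge0.
case: eqP => _ /=; first by rewrite mul1r normrN ger0_norm // tspeed_ge0.
by rewrite mul0r normr0.
Qed.

Lemma in_line_tpoint e q f :
  in_line f (tpoint e q : tangent G R) = (e == f) || (e == opposite f).
Proof.
rewrite /in_line; have [[-> _]//|[-> _ _]] := tpoint_repr e q.
by rewrite opposite_sym (can_eq (@oppositeK G)) orbC.
Qed.

Lemma sspeed_tpoint f q : sspeed f (tpoint f q : tangent G R) = q%:num.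
Proof.
rewrite /sspeed; have [[-> ->]|[-> -> ->]] := tpoint_repr f q.
  by rewrite eqxx.
by rewrite (negbTE (opposite_neq f)) eqxx oppr0.
Qed.

Lemma sspeed_tpoint_opposite f q :
  sspeed f (tpoint (opposite f) q : tangent G R) = - q%:num.
Proof.
have := sspeed_opposite (opposite f) (tpoint (opposite f) q).
by rewrite oppositeK sspeed_tpoint.
Qed.

Lemma in_line_spoint e s f :
  in_line f (spoint e s) = (e == f) || (e == opposite f).
Proof.
rewrite /spoint; case: ifP => _; rewrite in_line_tpoint //.
by rewrite opposite_sym (can_eq (@oppositeK G)) orbC.
Qed.

Lemma sspeed_spoint f s : sspeed f (spoint f s) = s.
Proof.
rewrite /spoint; case: lerP => s0; first by rewrite sspeed_tpoint /= ger0_norm.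
by rewrite sspeed_tpoint_opposite /= ltr0_norm ?opprK.
Qed.

Lemma sspeed_spoint_opposite f s : sspeed (opposite f) (spoint f s) = - s.
Proof. by rewrite sspeed_opposite sspeed_spoint. Qed.

(** The summand 1 in the metric separates different lines, so each line is both open and closed. *)
Lemma in_line_dist f x y : in_line f x != in_line f y -> 1 <= tdist x y.
Proof.
have := tspeed_ge0 x; have := tspeed_ge0 y.
rewrite /in_line /tdist => y0 x0; case: (eqVneq (tedge x) (tedge y)) => [->|xy].
  by rewrite eqxx.
case: (eqVneq (tedge x) (opposite (tedge y))) => [->|_ _]; last by lra.
by rewrite opposite_sym (can_eq (@oppositeK G)) orbC eqxx.
Qed.

Lemma line_ind_lipschitz f x y : `|line_ind f x - line_ind f y| <= tdist x y.
Proof.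
rewrite /line_ind; have [->|] := eqVneq (in_line f x) (in_line f y).
  rewrite subrr normr0 /tdist.
  have := tspeed_ge0 x; have := tspeed_ge0 y => y0 x0.
  by case: ifP => // _; case: ifP => _; lra.
move=> /[dup] /in_line_dist h1 xy; apply: le_trans h1.
by case: (in_line f x) (in_line f y) xy => [] [] //= _;
  rewrite ?subr0 ?sub0r ?normrN normr1.
Qed.

(** On a line the signed coordinate is an isometry, since opposite rays are glued with distance
    [q1 + q2]; between different lines the sum of the speeds already dominates. *)
Lemma sspeed_lipschitz f x y : `|sspeed f x - sspeed f y| <= tdist x y.
Proof.
have := tspeed_ge0 x; have := tspeed_ge0 y => y0 x0.
rewrite /tdist /sspeed; case: (eqVneq (tedge x) (tedge y)) => [->|xy].
  case: ifP => _ //; case: ifP => _; first by rewrite -opprD normrN.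
  by rewrite subrr normr0.
case: (eqVneq (tedge x) (opposite (tedge y))) => [xoy|xoy].
  rewrite xoy opposite_sym (can_eq (@oppositeK G)).
  case: (eqVneq (tedge y) f) => [->|yf]; last first.
    case: ifP => _; last by rewrite subr0 normr0 addr_ge0.
    by rewrite opprK ger0_norm // addr_ge0.
  by rewrite opposite_neqF -opprD normrN ger0_norm // addr_ge0.
rewrite ler_norml; apply/andP.
by do ![case: ifP => _]; split; lra.
Qed.

Lemma tspeed_lipschitz x y : `|tspeed x - tspeed y| <= tdist x y.
Proof.
have := tspeed_ge0 x; have := tspeed_ge0 y => y0 x0.
rewrite /tdist ler_norml; case: ifP => _; first by rewrite -ler_norml.
by apply/andP; case: ifP => _; split; lra.
Qed.

Lemma lipschitz_continuous (F : tangent G R -> R) :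
  (forall x y, `|F x - F y| <= tdist x y) -> continuous F.
Proof.
move=> lipF x U /nbhs_ballP[e /= e0 eU].
apply/nbhs_ballP; exists e => //= y; rewrite ballEmdist /= => xy; apply: eU.
exact: le_lt_trans (lipF x y) xy.
Qed.

Lemma continuous_tborel_measurable (F : tangent G R -> R) :
  continuous F -> measurable_fun [set: tborel G R] F.
Proof.
move=> /continuousP cF.
apply: (measurability _ (RGenOpens.measurableE R)) => _ [_ [a [b ->]] <-].
apply: measurableI => //; apply: sub_sigma_algebra; apply: cF.
exact: interval_open.
Qed.

Lemma measurable_line_ind f : measurable_fun [set: tborel G R] (line_ind f).
Proof.
apply: continuous_tborel_measurable; apply: lipschitz_continuous.
exact: line_ind_lipschitz.
Qed.

Lemma measurable_sspeed f : measurable_fun [set: tborel G R] (sspeed f).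
Proof.
apply: continuous_tborel_measurable; apply: lipschitz_continuous.
exact: sspeed_lipschitz.
Qed.

Lemma measurable_tspeed : measurable_fun [set: tborel G R] (@tspeed G R).
Proof.
apply: continuous_tborel_measurable; apply: lipschitz_continuous.
exact: tspeed_lipschitz.
Qed.

Lemma open_line f : open [set x | in_line f x].
Proof.
have -> : [set x | in_line f x] = line_ind f @^-1` `]0, +oo[.
  apply/seteqP; split => x /=; rewrite in_itv /= /line_ind andbT.
    by move=> ->; rewrite ltr01.
  by case: in_line; rewrite ?ltxx.
apply: open_comp => [x _|]; last exact: interval_open.
by apply: lipschitz_continuous; exact: line_ind_lipschitz.
Qed.

(* The lines of [f] and [- f] coincide, so every point is counted twice. *)
Lemma sum_line (F : edge G -> R) x :
  \sum_f line_ind f x * F f = F (tedge x) + F (opposite (tedge x)).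
Proof.
rewrite (bigD1 (tedge x)) //= (bigD1 (opposite (tedge x))) ?opposite_neq //=.
rewrite /line_ind in_line_opposite [in_line (tedge x) x]/in_line eqxx !mul1r.
rewrite big1 ?addr0 // => f /andP[f1 f2]; rewrite /in_line eq_sym (negbTE f1).
by rewrite -opposite_sym eq_sym (negbTE f2) mul0r.
Qed.

Lemma line_ind_sspeed f x : line_ind f x * sspeed f x = sspeed f x.
Proof.
rewrite /line_ind; case: (boolP (in_line f x)); first by rewrite mul1r.
by move=> /sspeed_out ->; rewrite mulr0.
Qed.

Lemma sum_line_ind x : \sum_f line_ind f x = 2.
Proof. by under eq_bigr do rewrite -[line_ind _ _]mulr1; rewrite sum_line. Qed.

(** Reversing the edge changes both signs, so the two orientations of the line through [x]
    contribute equally. *)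
Lemma sum_sspeed (w : cochain1 G R) x :
  \sum_f sspeed f x * w f = 2 * (tspeed x * w (tedge x)).
Proof.
under eq_bigr do rewrite -line_ind_sspeed -mulrA.
rewrite sum_line sspeed_opposite (eqP (forallP (cochain_antisym w) _)).
by rewrite sspeed_tedge //; ring.
Qed.

End tangent_functions.

(** * The Lagrangian and cochains as functions of signed speeds *)

Section lagrangian_functions.
Variables (G : graph) (R : realType) (H : edge G -> R -> R).
Hypothesis H_ham : hamiltonian H.
Local Notation L := (lagrangian_edge H).

(** Negative arguments of [L e] are thus speeds on the opposite ray: a single function on the real
    line describes the Lagrangian on both rays. *)
Lemma lagrangian_edge_opposite e s : L (opposite e) s = L e (- s).
Proof.
congr sup; apply/seteqP; split => _ [p _ <-]; exists (- p) => //.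
  by rewrite mulrNN (ham_opposite H_ham e) opprK.
by rewrite (ham_opposite H_ham e p); congr (_ - _); ring.
Qed.

Lemma lagrangian_edge_ub e p q : p * q - H e p <= L e q.
Proof. by case: H_ham => _ _ dH pH nH; exact: legendre_ub. Qed.

Lemma lagrangian_edge_subgradient e t :
  exists p, forall s, s != t -> L e t + p * (s - t) < L e s.
Proof. by case: H_ham => _ _ dH pH nH; exact: legendre_strict_subgradient. Qed.

Lemma measurable_lagrangian_edge e : measurable_fun setT (L e).
Proof. by case: H_ham => _ _ dH pH nH; exact: measurable_legendre. Qed.

(** The half compensates for the two orientations of each line. This form avoids the choice of
    representative in [tedge] and makes measurability visible. *)
Lemma lagrangianE x : lagrangian H x =
  2^-1 * \sum_f line_ind f x * L f (sspeed f x).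
Proof.
rewrite sum_line lagrangian_edge_opposite sspeed_opposite opprK sspeed_tedge //.
by rewrite /lagrangian; field.
Qed.

Lemma lagrangian_spoint e s : lagrangian H (spoint e s) = L e s.
Proof.
rewrite /spoint; case: lerP => s0; rewrite lagrangian_tpoint //=.
  by rewrite ger0_norm.
by rewrite lagrangian_edge_opposite ltr0_norm ?opprK.
Qed.

Lemma measurable_lagrangian :
  measurable_fun [set: tborel G R] (lagrangian H).
Proof.
rewrite (_ : lagrangian H =
  fun x => 2^-1 * \sum_f line_ind f x * L f (sspeed f x)); last first.
  by apply/funext => x; exact: lagrangianE.
apply: measurable_funM; first exact: measurable_cst.
apply: measurable_sum => f; apply: measurable_funM.
  exact: measurable_line_ind.
apply: (measurableT_comp (measurable_lagrangian_edge f)).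
exact: measurable_sspeed.
Qed.

(** The cochain as a function on the tangent space; its integral is the pairing with the rotation
    vector. *)
Definition momentum (w : cochain1 G R) (x : tangent G R) : R :=
  tspeed x * w (tedge x).

Lemma momentumE w x : momentum w x = 2^-1 * \sum_f sspeed f x * w f.
Proof. by rewrite sum_sspeed /momentum; field. Qed.

Lemma momentum_spoint w e s : momentum w (spoint e s) = s * w e.
Proof.
rewrite momentumE (bigD1 e) //= (bigD1 (opposite e)) ?opposite_neq //=.
rewrite sspeed_spoint sspeed_spoint_opposite (eqP (forallP (cochain_antisym w) _)).
rewrite big1 => [|f /andP[fe foe]]; first by field.
rewrite sspeed_out ?mul0r // in_line_spoint.
by rewrite eq_sym (negbTE fe) -opposite_sym eq_sym.
Qed.

Lemma measurable_momentum w : measurable_fun [set: tborel G R] (momentum w).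
Proof.
rewrite (_ : momentum w = fun x => 2^-1 * \sum_f sspeed f x * w f); last first.
  by apply/funext => x; exact: momentumE.
apply: measurable_funM; first exact: measurable_cst.
apply: measurable_sum => f; apply: measurable_funM; last exact: measurable_cst.
exact: measurable_sspeed.
Qed.

Lemma twisted_lagrangianE w x :
  twisted_lagrangian H w x = lagrangian H x - momentum w x.
Proof. by []. Qed.

Lemma measurable_twisted_lagrangian w :
  measurable_fun [set: tborel G R] (twisted_lagrangian H w).
Proof.
apply: measurable_funB; first exact: measurable_lagrangian.
exact: measurable_momentum.
Qed.

Lemma twisted_lagrangian0 : twisted_lagrangian H 0 = lagrangian H.
Proof.
apply/funext => x.
by rewrite twisted_lagrangianE /momentum /= ffunE mulr0 subr0.
Qed.

(** The Legendre inequality at [p = w e] bounds the function below by [- H e (w e)], and there are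
    finitely many edges. *)
Lemma twisted_lagrangian_lb w : exists C, forall x, - C <= twisted_lagrangian H w x.
Proof.
exists (\sum_e `|H e (w e)|) => x.
have : `|H (tedge x) (w (tedge x))| <= \sum_e `|H e (w e)|.
  by rewrite (bigD1 (tedge x)) //= lerDl sumr_ge0.
have := ler_norm (H (tedge x) (w (tedge x))).
have := lagrangian_edge_ub (tedge x) (w (tedge x)) (tspeed x).
rewrite /twisted_lagrangian /lagrangian mulrC; lra.
Qed.

End lagrangian_functions.

(** * Discrete measures and rotation vectors *)

Section bounded_below_integral.
Context d (T : measurableType d) (R : realType).
Variables (mu : probability T R) (F : T -> R) (C : R).
Hypothesis mF : measurable_fun setT F.
Hypothesis F_lb : forall x, - C <= F x.

Lemma integral_funeneg_lty : (\int[mu]_x ((EFin \o F)^\- x) < +oo)%E.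
Proof.
have C0 : 0 <= `|C| by [].
apply: (@le_lt_trans _ _ (\int[mu]_x (cst `|C|%:E x))%E).
  apply: ge0_le_integral => //.
  - by apply/measurable_funeneg/measurable_EFinP.
  - move=> x _; rewrite funenegE /= -EFin_max lee_fin ge_max C0 andbT.
    by have := F_lb x; have := ler_norm C; lra.
by rewrite integral_cst //= probability_setT mule1 ltry.
Qed.

(** The negative part is bounded on a probability space, hence of finite integral, so the positive
    part must have finite integral as well. *)
Lemma bounded_below_integrable : (\int[mu]_x (F x)%:E < +oo)%E ->
  mu.-integrable setT (EFin \o F).
Proof.
have mEF : measurable_fun setT (EFin \o F) by exact/measurable_EFinP.
have N := integral_funeneg_lty.
have N0 : (0 <= \int[mu]_x ((EFin \o F)^\- x))%E by apply: integral_ge0.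
have P0 : (0 <= \int[mu]_x ((EFin \o F)^\+ x))%E by apply: integral_ge0.
rewrite (integralE _ _ (EFin \o F)) => PN; apply/integrableP; split => //.
rewrite (_ : (fun x => _) = (EFin \o F)^\+ \+ (EFin \o F)^\-)%E; last first.
  by rewrite -fune_abse.
rewrite ge0_integralD //; [|exact: measurable_funepos|exact: measurable_funeneg].
move: N N0 P0 PN; case: (integral _ _ _) => [n| |]; case: (integral _ _ _) => //.
by move=> p; rewrite -EFinD !ltry.
Qed.

End bounded_below_integral.

(** * Finite convex combinations of Dirac masses *)

Section discrete_measure.
Context d (T : measurableType d) (R : realType) (I : finType).
Variables (i0 : I) (w : I -> {nonneg R}) (x : I -> T).
Hypothesis w_sum : \sum_i (w i)%:num = 1.

(** [msum] is indexed by natural numbers, hence the enumeration of [I]; the default [i0] is never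
    reached below [#|I|]. *)
Let m_ (n : nat) : {measure set T -> \bar R} :=
  mscale (w (nth i0 (enum I) n)) (dirac (x (nth i0 (enum I) n))).

Definition discrete : set T -> \bar R := msum m_ #|I|.

HB.instance Definition _ := Measure.on discrete.

Let sum_nth (F : I -> \bar R) :
  (\sum_(n < #|I|) F (nth i0 (enum I) n) = \sum_i F i)%E.
Proof. by rewrite -[RHS]big_enum (big_nth i0) big_mkord -cardE. Qed.

Let discrete_setT : discrete setT = 1%E.
Proof.
rewrite /discrete /msum -w_sum -sumEFin -sum_nth; apply: eq_bigr => n _.
by rewrite /= /mscale /= diracT mule1.
Qed.

HB.instance Definition _ := Measure_isProbability.Build _ _ _ discrete discrete_setT.

Lemma discrete_exists : exists nu : probability T R,
  forall F : T -> R, measurable_fun setT F ->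
    (\int[nu]_y (F y)%:E = (\sum_i (w i)%:num * F (x i))%:E)%E.
Proof.
exists discrete => F mF.
have mEF : measurable_fun setT (EFin \o F) by exact/measurable_EFinP.
(* Additivity in the measure gives the nonnegative case; the general one follows from the positive
   and negative parts, whose integrals are finite. *)
have pos (g : T -> R) : measurable_fun setT g -> (forall y, 0 <= g y) ->
    (\int[discrete]_y (g y)%:E = (\sum_i (w i)%:num * g (x i))%:E)%E.
  move=> mg g0; have mEg : measurable_fun setT (EFin \o g) by exact/measurable_EFinP.
  rewrite /= ge0_integral_measure_sum //; last by move=> y _; rewrite lee_fin.
  rewrite -sumEFin -sum_nth; apply: eq_bigr => n _.
  rewrite ge0_integral_mscale //; last by move=> y _; rewrite lee_fin.
  by rewrite integral_dirac // diracT mul1e.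
rewrite (integralE _ _ (EFin \o F)).
under eq_integral do rewrite funeposE /= -EFin_max.
under [X in (_ - X)%E]eq_integral do rewrite funenegE /= -EFin_max.
rewrite (pos (fun y => Num.max (F y) 0)); first last.
- by move=> y; rewrite le_max lexx orbT.
- exact: measurable_maxr.
rewrite (pos (fun y => Num.max (- F y) 0)); first last.
- by move=> y; rewrite le_max lexx orbT.
- by apply: measurable_maxr => //; exact: measurable_funN.
rewrite -EFinB -sumrB; congr EFin; apply: eq_bigr => i _.
rewrite -mulrBr; congr (_ * _).
by case: lerP => ?; case: lerP => ?; lra.
Qed.

End discrete_measure.

(** * Rotation vectors as integrals of signed speeds *)

Section rotation_vector.
Variables (G : graph) (R : realType).
Local Notation bprob := (probability (tborel G R) R).
Implicit Types (mu : bprob) (f : edge G) (x : tangent G R).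

(** The indicator of [e] minus that of [opposite e] is a cochain; it reads off a difference of
    coefficients, and these differences determine a chain modulo reversal-invariant families. *)
Lemma pairing_inj (a b : chain1 G R) :
  (forall w, pairing w a = pairing w b) -> a = b.
Proof.
move=> ab.
have anti e : [ffun f => (f == e)%:R - (f == opposite e)%:R : R]
    \in @antisymmetric_edge G R.
  apply/forallP => f; rewrite !ffunE opprB opposite_sym.
  by rewrite (can_eq (@oppositeK G)).
have pairE e (z : chain1 G R) :
    pairing (Cochain1 (anti e)) z = coef z e - coef z (opposite e).
  rewrite /pairing (bigD1 e) //= (bigD1 (opposite e)) ?opposite_neq //=.
  rewrite !ffunE !eqxx opposite_neqF (negbTE (opposite_neq e)).
  rewrite big1 => [|f /andP[/negbTE fe /negbTE foe]].
    by rewrite subr0 sub0r mulr1 mulrN1 addr0.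
  by rewrite ffunE fe foe subrr mulr0.
rewrite -[a]reprK -[b]reprK; apply/eqP.
rewrite -Quotient.idealrBE; apply/forallP => e; rewrite !ffunE.
have := ab (Cochain1 (anti e)); rewrite !pairE /coef => E.
apply/eqP; lra.
Qed.

Lemma homology1P (a : chain1 G R) :
  (forall g, pairing (coboundary g) a = 0) -> homology1 a.
Proof.
move=> a0; apply/ffunP => v; rewrite [RHS]ffunE.
have := a0 [ffun u => (u == v)%:R]; rewrite pairing_coboundary (bigD1 v) //=.
rewrite [X in X * _]ffunE eqxx mul1r big1 ?addr0 // => u /negbTE uv.
by rewrite ffunE uv mul0r.
Qed.

Lemma pairing_homology1 g (a : chain1 G R) :
  homology1 a -> pairing (coboundary g) a = 0.
Proof.
by move=> a0; rewrite pairing_coboundary big1 // => v _; rewrite a0 ffunE mulr0.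
Qed.

(** Turns integrals over a ray into integrals of a positive part over the whole space. *)
Lemma tspeed_ray f x :
  (@tspeed G R \_ (ray f)) x = Num.max (sspeed f x) 0.
Proof.
have rayP : reflect (ray f x) (x \in ray f) by apply: (iffP idP); rewrite inE.
rewrite patchE; have x0 := tspeed_ge0 x; case: rayP => [[q _ <-]|nray].
  by rewrite sspeed_tpoint tspeed_tpoint; apply/esym/max_idPl.
have xf : tedge x != f.
  by apply/eqP => xf; apply: nray; rewrite (tpointE x) xf; exists (repr x).2.
rewrite /sspeed (negbTE xf).
by case: ifP => _; apply/esym/max_idPr => //; rewrite oppr_le0.
Qed.

Lemma integrable_tspeed mu : finite_moment_measures mu ->
  mu.-integrable setT (EFin \o @tspeed G R).
Proof.
move=> fm; apply: (@bounded_below_integrable _ _ _ _ _ 0) => //.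
  exact: measurable_tspeed.
by move=> x; rewrite oppr0 tspeed_ge0.
Qed.

Lemma integrable_le_tspeed mu (F : tangent G R -> R) :
  finite_moment_measures mu -> measurable_fun [set: tborel G R] F ->
  (forall x, `|F x| <= tspeed x) -> mu.-integrable setT (EFin \o F).
Proof.
move=> fm mF Fle; apply: le_integrable (integrable_tspeed fm) => //.
  exact/measurable_EFinP.
by move=> x _ /=; rewrite lee_fin (ger0_norm (tspeed_ge0 x)).
Qed.

Lemma integrable_sspeed mu f : finite_moment_measures mu ->
  mu.-integrable setT (EFin \o sspeed f).
Proof.
move=> fm; apply: integrable_le_tspeed => //; first exact: measurable_sspeed.
move=> x; rewrite sspeed_abs /line_ind; case: in_line; rewrite ?mul1r // mul0r.
exact: tspeed_ge0.
Qed.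

Lemma integrable_EFin_sum (I : Type) (r : seq I) mu (F : I -> tangent G R -> R) :
  (forall i, mu.-integrable setT (EFin \o F i)) ->
  mu.-integrable setT (EFin \o (fun x => \sum_(i <- r) F i x)).
Proof.
move=> iF; rewrite (_ : EFin \o _ = fun x => \sum_(i <- r) (F i x)%:E)%E.
  by apply: integrable_sum => // i _; exact: iF.
by apply/funext => x; rewrite /= sumEFin.
Qed.

Lemma Rintegral_sum (I : Type) (r : seq I) mu (F : I -> tangent G R -> R) :
  (forall i, mu.-integrable setT (EFin \o F i)) ->
  \int[mu]_x (\sum_(i <- r) F i x) = \sum_(i <- r) \int[mu]_x F i x.
Proof.
move=> iF; elim: r => [|i r IH].
  under eq_Rintegral do rewrite big_nil.
  by rewrite big_nil /Rintegral integral0.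
under eq_Rintegral do rewrite big_cons.
rewrite RintegralD //; first by rewrite IH big_cons.
exact: integrable_EFin_sum.
Qed.

(** The coefficient of [rho mu] at [f] integrates the positive part of the signed speed, the one at
    [opposite f] its negative part. The mean signed speed is their difference, and antisymmetry of
    [w] produces the factor. *)
Lemma pairing_rho (w : cochain1 G R) mu : finite_moment_measures mu ->
  pairing w (rho mu) = 2^-1 * \sum_f (\int[mu]_x sspeed f x) * w f.
Proof.
move=> fm; rewrite /rho pairing_chain_of.
pose r f := \int[mu]_x Num.max (sspeed f x) 0.
have mmax f : measurable_fun [set: tborel G R] (fun x => Num.max (sspeed f x) 0).
  by apply: measurable_maxr => //; exact: measurable_sspeed.
have imax f : mu.-integrable setT (EFin \o (fun x => Num.max (sspeed f x) 0)).
  apply: le_integrable (integrable_sspeed f fm) => //.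
    exact/measurable_EFinP.
  by move=> x _ /=; rewrite lee_fin; case: (lerP (sspeed f x) 0); rewrite ?normr0.
have rE f : fine (\int[mu]_(x in ray f) (tspeed x)%:E)%E = r f.
  rewrite /r /Rintegral; congr fine; rewrite [LHS]integral_mkcond.
  apply: eq_integral => x _.
  by rewrite restrict_EFin /= tspeed_ray.
have sE f : \int[mu]_x sspeed f x = r f - r (opposite f).
  rewrite -RintegralB //; apply: eq_Rintegral => x _.
  by rewrite sspeed_opposite; case: lerP => ?; case: lerP => ?; lra.
under eq_bigr do rewrite rE.
under [in RHS]eq_bigr do rewrite sE mulrBl.
rewrite sumrB [X in _ - X](reindex_inj (inv_inj (@oppositeK G))) /=.
under [X in _ - X]eq_bigr do
  rewrite oppositeK (eqP (forallP (cochain_antisym w) _)) mulrN.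
by rewrite sumrN; field.
Qed.

Lemma pairing_rhoE (w : cochain1 G R) mu : finite_moment_measures mu ->
  pairing w (rho mu) = \int[mu]_x momentum w x.
Proof.
move=> fm; rewrite pairing_rho //; apply/esym.
have isw f : mu.-integrable setT (EFin \o (fun x => sspeed f x * w f)).
  exact: integrableZr (integrable_sspeed f fm).
under eq_Rintegral do rewrite momentumE.
rewrite RintegralZl //; last first.
  exact: integrable_EFin_sum.
congr (_ * _); rewrite Rintegral_sum //.
by apply: eq_bigr => f _; rewrite RintegralZr //; exact: integrable_sspeed.
Qed.

Lemma integrable_momentum (w : cochain1 G R) mu : finite_moment_measures mu ->
  mu.-integrable setT (EFin \o momentum w).
Proof.
move=> fm; rewrite (_ : EFin \o momentum w =
    fun x => ((2^-1)%:E * \sum_f (sspeed f x * w f)%:E)%E); last first.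
  by apply/funext => x; rewrite /= momentumE sumEFin EFinM.
apply: integrableZl => //; apply: integrable_sum => // f _.
exact: integrableZr (integrable_sspeed f fm).
Qed.

End rotation_vector.

(** * Jensen's inequality along the lines *)

Section integrable_EFin.
Context d (T : measurableType d) (R : realType).
Variables (mu : {measure set T -> \bar R}) (f g : T -> R).
Hypothesis int_f : mu.-integrable setT (EFin \o f).
Hypothesis int_g : mu.-integrable setT (EFin \o g).

Lemma integrable_EFinD : mu.-integrable setT (EFin \o (fun x => f x + g x)).
Proof. exact: (integrableD measurableT int_f int_g). Qed.

Lemma integrable_EFinB : mu.-integrable setT (EFin \o (fun x => f x - g x)).
Proof. exact: (integrableB measurableT int_f int_g). Qed.

Lemma integrable_EFinZl k : mu.-integrable setT (EFin \o (fun x => k * f x)).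
Proof. exact: (integrableZl measurableT k int_f). Qed.

End integrable_EFin.

Section jensen.
Variables (G : graph) (R : realType) (H : edge G -> R -> R).
Hypothesis H_ham : hamiltonian H.
Local Notation L := (lagrangian_edge H).
Local Notation bprob := (probability (tborel G R) R).
Implicit Types (mu : bprob) (f : edge G) (x : tangent G R).

Definition line_mass mu f : R := \int[mu]_x line_ind f x.
Definition line_speed mu f : R := \int[mu]_x sspeed f x.

Lemma line_mass_ge0 mu f : 0 <= line_mass mu f.
Proof. by apply: Rintegral_ge0 => x _; rewrite /line_ind ler0n. Qed.

Lemma integrable_line_ind mu f : mu.-integrable setT (EFin \o line_ind f).
Proof.
apply: le_integrable (finite_measure_integrable_cst mu 1 measurableT) => //.
  by apply/measurable_EFinP; exact: measurable_line_ind.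
move=> x _ /=; rewrite lee_fin /line_ind.
by case: in_line; rewrite ?normr0 ?normr1.
Qed.

Lemma sum_line_mass mu : \sum_f line_mass mu f = 2.
Proof.
rewrite -Rintegral_sum; last by move=> f; exact: integrable_line_ind.
under eq_Rintegral do rewrite sum_line_ind.
rewrite Rintegral_cst //.
rewrite -[RHS]mulr1; congr (_ * _); rewrite -[RHS]/(fine 1%E); congr fine.
exact: probability_setT.
Qed.

(** The signed speed vanishes off the line, hence almost everywhere here. This covers the division
    by zero in the mean speed below. *)
Lemma line_speed_null mu f : line_mass mu f = 0 -> line_speed mu f = 0.
Proof.
move=> m0.
have mE : measurable_fun [set: tborel G R] (EFin \o @line_ind G R f).
  by apply/measurable_EFinP; exact: measurable_line_ind.
have : ae_eq mu setT (EFin \o @line_ind G R f) (cst 0%E).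
  apply/ae_eq_integral_abs => //.
  under eq_integral do rewrite /= ger0_norm ?ler0n //.
  have /= := integrable_fin_num measurableT (integrable_line_ind mu f).
  by move=> /fineK <-; rewrite -[fine _]/(line_mass mu f) m0.
move=> ae0; rewrite /line_speed /Rintegral (@ae_eq_integral _ _ _ mu setT (cst 0%E)).
- by rewrite integral0.
- by [].
- by apply/measurable_EFinP; exact: measurable_sspeed.
- exact: measurable_cst.
apply: filterS ae0 => x /= /(_ I) [E0] _.
by rewrite -line_ind_sspeed E0 mul0r.
Qed.

Section gap.
(* [p f] is a subgradient of the Lagrangian of [f] at [s f]; the gap is the
   Jensen defect, nonnegative and zero exactly where the speed is [s f]. *)
Variables s p : edge G -> R.
Hypothesis sp : forall f t, t != s f -> L f (s f) + p f * (t - s f) < L f t.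

Definition gap x : R := 2^-1 * \sum_f line_ind f x *
  (L f (sspeed f x) - (L f (s f) + p f * (sspeed f x - s f))).

Let term_ge0 f x : 0 <= line_ind f x *
  (L f (sspeed f x) - (L f (s f) + p f * (sspeed f x - s f))).
Proof.
rewrite mulr_ge0 ?ler0n // subr_ge0.
by have [->|/sp/ltW//] := eqVneq (sspeed f x) (s f); rewrite subrr mulr0 addr0.
Qed.

Lemma gap_ge0 x : 0 <= gap x.
Proof. by rewrite mulr_ge0 ?invr_ge0 // sumr_ge0. Qed.

Lemma gap_gt0 f x : in_line f x -> sspeed f x != s f -> 0 < gap x.
Proof.
move=> xf xs; rewrite mulr_gt0 ?invr_gt0 // (bigD1 f) //= ltr_pwDl ?sumr_ge0 //.
by rewrite /line_ind xf mul1r subr_gt0 sp.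
Qed.

(** The correction is a combination of line indicators and signed speeds, so its integral depends on
    the measure only through line masses and line speeds. *)
Lemma gapE x : gap x = lagrangian H x -
  2^-1 * \sum_f (line_ind f x * (L f (s f) - p f * s f) + sspeed f x * p f).
Proof.
rewrite (lagrangianE H_ham) -mulrBr -sumrB /gap; congr (_ * _).
by apply: eq_bigr => f _; rewrite -[in X in _ + X * _](line_ind_sspeed f); ring.
Qed.

Lemma measurable_gap : measurable_fun [set: tborel G R] gap.
Proof.
apply: measurable_funM; first exact: measurable_cst.
apply: measurable_sum => f; apply: measurable_funM.
  exact: measurable_line_ind.
apply: measurable_funB.
  apply: (measurableT_comp (measurable_lagrangian_edge H_ham f)).
  exact: measurable_sspeed.
apply: measurable_funD; first exact: measurable_cst.
apply: measurable_funM; first exact: measurable_cst.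
apply: measurable_funB; last exact: measurable_cst.
exact: measurable_sspeed.
Qed.

Variable mu : bprob.
Hypothesis mu_fm : finite_moment_measures mu.
Hypothesis mu_L : mu.-integrable setT (EFin \o lagrangian H).

Let integrable_terms f : mu.-integrable setT (EFin \o
  (fun x => line_ind f x * (L f (s f) - p f * s f) + sspeed f x * p f)).
Proof.
apply: integrable_EFinD.
  exact: integrableZr (integrable_line_ind mu f).
exact: integrableZr (integrable_sspeed f mu_fm).
Qed.

Let integrable_sum_terms : mu.-integrable setT (EFin \o (fun x =>
  2^-1 * \sum_f (line_ind f x * (L f (s f) - p f * s f) + sspeed f x * p f))).
Proof.
exact/integrable_EFinZl/integrable_EFin_sum.
Qed.

Lemma Rintegral_gap : \int[mu]_x gap x = \int[mu]_x lagrangian H x -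
  2^-1 * \sum_f (line_mass mu f * (L f (s f) - p f * s f) + line_speed mu f * p f).
Proof.
under eq_Rintegral do rewrite gapE.
rewrite RintegralB //; congr (_ - _).
rewrite RintegralZl //; last exact: integrable_EFin_sum.
congr (_ * _); rewrite Rintegral_sum //; apply: eq_bigr => f _.
rewrite RintegralD //; last 2 first.
- exact: integrableZr (integrable_line_ind mu f).
- exact: integrableZr (integrable_sspeed f mu_fm).
rewrite RintegralZr //; last exact: integrable_line_ind.
by rewrite RintegralZr //; exact: integrable_sspeed.
Qed.

Lemma integrable_gap : mu.-integrable setT (EFin \o gap).
Proof.
rewrite (_ : gap = fun x => lagrangian H x -
  2^-1 * \sum_f (line_ind f x * (L f (s f) - p f * s f) + sspeed f x * p f)).
  exact: integrable_EFinB.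
by apply/funext => x; exact: gapE.
Qed.

(** A nonnegative function of zero integral vanishes almost everywhere. The points of the line with
    another speed form an open set where the gap is positive, so this set is null and misses the
    support. *)
Lemma gap_support f x : \int[mu]_x gap x = 0 ->
  msupport mu x -> in_line f x -> sspeed f x = s f.
Proof.
move=> gap0 xmu xf; apply/eqP/negPn/negP => xs.
pose U := [set y | in_line f y] `&` (@sspeed G R f @^-1` [set t | t != s f]).
have oU : open U.
  apply: openI; first exact: open_line.
  apply: open_comp => [y _|]; last exact: open_neq.
  by apply: lipschitz_continuous; exact: sspeed_lipschitz.
have ae0 : ae_eq mu setT (EFin \o gap) (cst 0%E).
  apply/ae_eq_integral_abs => //.
    by apply/measurable_EFinP; exact: measurable_gap.
  under eq_integral do rewrite /= ger0_norm ?gap_ge0 //.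
  have /= := integrable_fin_num measurableT integrable_gap.
  by move=> /fineK <-; rewrite -[fine _]/(\int[mu]_x gap x) gap0.
have muU : mu U = 0%E.
  have mU : measurable (U : set (tborel G R)) by exact: sub_sigma_algebra.
  apply/(negligibleP _ mU); apply: negligibleS ae0 => y [/= yf ys] /(_ I) [E0].
  by have := gap_gt0 yf ys; rewrite E0 ltxx.
by suff /(xmu U oU) : U x by rewrite muU ltxx.
Qed.

End gap.

(** Barycentre, on the line of [f], of the average of the two measures; it is 0 by convention on a
    massless line. *)
Definition mean_speed mu1 mu2 f : R :=
  (line_speed mu1 f + line_speed mu2 f) / (line_mass mu1 f + line_mass mu2 f).

Lemma mean_speedE mu1 mu2 f :
  (line_mass mu1 f + line_mass mu2 f) * mean_speed mu1 mu2 f =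
  line_speed mu1 f + line_speed mu2 f.
Proof.
have [m0|m0] := eqVneq (line_mass mu1 f + line_mass mu2 f) 0; last first.
  by rewrite /mean_speed mulrC divfK.
have := line_mass_ge0 mu1 f; have := line_mass_ge0 mu2 f => m2 m1.
by rewrite m0 mul0r !line_speed_null ?addr0 //; lra.
Qed.

Section two_measures.
Variables mu1 mu2 : bprob.
Hypotheses (fm1 : finite_moment_measures mu1) (fm2 : finite_moment_measures mu2).
Hypothesis L1 : mu1.-integrable setT (EFin \o lagrangian H).
Hypothesis L2 : mu2.-integrable setT (EFin \o lagrangian H).
Local Notation s := (mean_speed mu1 mu2).

(** Twice the action of the measure obtained by concentrating the average of [mu1] and [mu2] at its
    barycentre on each line. *)
Definition mean_action : R :=
  2^-1 * \sum_f (line_mass mu1 f + line_mass mu2 f) * L f (s f).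

Let subgradients : exists p, forall f t,
  t != s f -> L f (s f) + p f * (t - s f) < L f t.
Proof.
have /choice[p sp] f := lagrangian_edge_subgradient H_ham f (s f).
by exists p.
Qed.

(** The slopes [p] cancel because [s] is the mean speed of the two measures together. *)
Let Rintegral_gaps p (sp : forall f t,
    t != s f -> L f (s f) + p f * (t - s f) < L f t) :
  \int[mu1]_x gap s p x + \int[mu2]_x gap s p x =
  \int[mu1]_x lagrangian H x + \int[mu2]_x lagrangian H x - mean_action.
Proof.
rewrite !Rintegral_gap // /mean_action.
set A1 := \int[mu1]_x _; set A2 := \int[mu2]_x _.
suff -> : \sum_f (line_mass mu1 f + line_mass mu2 f) * L f (s f) =
    \sum_f (line_mass mu1 f * (L f (s f) - p f * s f) + line_speed mu1 f * p f) +
    \sum_f (line_mass mu2 f * (L f (s f) - p f * s f) + line_speed mu2 f * p f).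
  by ring.
rewrite -big_split; apply: eq_bigr => f _ /=.
have := mean_speedE mu1 mu2 f; set M1 := line_mass mu1 f.
set M2 := line_mass mu2 f; set S1 := line_speed mu1 f.
move=> E; have -> : line_speed mu2 f = (M1 + M2) * s f - S1 by rewrite E; ring.
by ring.
Qed.

Lemma mean_action_le :
  mean_action <= \int[mu1]_x lagrangian H x + \int[mu2]_x lagrangian H x.
Proof.
have [p sp] := subgradients; rewrite -subr_ge0 -(Rintegral_gaps sp).
by apply: addr_ge0; apply: Rintegral_ge0 => x _; exact: gap_ge0.
Qed.

(** Equality case of Jensen: two nonnegative gap integrals with nonpositive sum both vanish. *)
Lemma mean_action_support :
  \int[mu1]_x lagrangian H x + \int[mu2]_x lagrangian H x <= mean_action ->
  forall f x, msupport mu1 x \/ msupport mu2 x -> in_line f x ->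
  sspeed f x = s f.
Proof.
move=> le_mean f x x12 xf; have [p sp] := subgradients.
have := Rintegral_gaps sp.
have g1 : 0 <= \int[mu1]_x gap s p x by apply: Rintegral_ge0 => y _; exact: gap_ge0.
have g2 : 0 <= \int[mu2]_x gap s p x by apply: Rintegral_ge0 => y _; exact: gap_ge0.
move=> E; case: x12 => xmu.
  by apply: (gap_support sp fm1 L1) => //; lra.
by apply: (gap_support sp fm2 L2) => //; lra.
Qed.

End two_measures.

End jensen.

(** * Minimizing measures *)

Section mather_theory.
Variables (G : graph) (R : realType) (H : edge G -> R -> R).
Hypothesis H_ham : hamiltonian H.
Local Notation L := (lagrangian_edge H).
Local Notation bprob := (probability (tborel G R) R).
Implicit Types (mu : bprob) (f : edge G) (c : cohomology1 G R) (h : chain1 G R).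

Section discrete_competitor.
Variables w s : edge G -> R.
Hypotheses (w_ge0 : forall e, 0 <= w e) (w_sum : \sum_e w e = 1).

Lemma discrete_tangent_measure : exists nu : bprob,
  [/\ finite_moment_measures nu,
      forall z, pairing z (rho nu) = \sum_e w e * (s e * z e) &
      action H nu = (\sum_e w e * L e (s e))%:E].
Proof.
have [nu nuE] := @discrete_exists _ (tborel G R) R (edge G)
  (enum_val (Ordinal (edge_gt0 G))) (fun e => NngNum (w_ge0 e))
  (fun e => spoint e (s e)) w_sum.
have fm : finite_moment_measures nu.
  rewrite /finite_moment_measures /= nuE ?ltry //.
  exact: measurable_tspeed.
exists nu; split=> // [z|].
  rewrite pairing_rhoE // /Rintegral nuE /=; last exact: measurable_momentum.
  by apply: eq_bigr => e _; rewrite momentum_spoint.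
rewrite /action nuE; last exact: measurable_lagrangian.
by congr EFin; apply: eq_bigr => e _; rewrite lagrangian_spoint.
Qed.

Lemma beta_le_discrete h : homology1 h ->
  (forall z : cochain1 G R, \sum_e w e * (s e * z e) = pairing z h) ->
  (beta H h <= (\sum_e w e * L e (s e))%:E)%E.
Proof.
move=> h0 wsh; have [nu [fm rhonu <-]] := discrete_tangent_measure.
have rhoh : rho nu = h by apply: pairing_inj => z; rewrite rhonu wsh.
apply: ereal_inf_lbound; exists nu => //; split=> //; split=> // g.
by rewrite /int_cochain rhoh pairing_homology1.
Qed.

Lemma alpha_ge_discrete c :
  (forall g, \sum_e w e * (s e * coboundary g e) = 0) ->
  ((\sum_e w e * (s e * cohom_repr c e) - \sum_e w e * L e (s e))%:E
    <= alpha H c)%E.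
Proof.
move=> ws0; have [nu [fm rhonu nuL]] := discrete_tangent_measure.
have nu0 : homology1 (rho nu) by apply: homology1P => g; rewrite rhonu.
apply: (@le_trans _ _ ((pairing_cohom c (rho nu))%:E - beta H (rho nu))%E).
  rewrite /pairing_cohom rhonu EFinB leeB //.
  by apply: beta_le_discrete => // z; rewrite rhonu.
by apply: ereal_sup_ubound; exists (rho nu).
Qed.

End discrete_competitor.

(** Uniform weights, with the coefficients of [h] multiplied by the number of edges as signed
    speeds, give a competitor of finite action. *)
Lemma beta_lty h : homology1 h -> (beta H h < +oo)%E.
Proof.
move=> h0; have n0 : (#|edge G|%:R : R) != 0.
  by rewrite pnatr_eq0 -lt0n edge_gt0.
apply: le_lt_trans (ltry _).
apply: (@beta_le_discrete (fun=> #|edge G|%:R^-1)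
  (fun e => #|edge G|%:R * coef h e)) => //.
  by rewrite sumr_const -[LHS]mulr_natr mulVf.
by move=> z; apply: eq_bigr => e _; rewrite -mulrA mulKf.
Qed.

(** The competitor is the Dirac mass at the origin of the line of [f]. *)
Lemma alpha_ge_static c f : ((- L f 0)%:E <= alpha H c)%E.
Proof.
have sumE (F : edge G -> R) : \sum_e (e == f)%:R * F e = F f.
  rewrite (bigD1 f) //= eqxx mul1r big1 ?addr0 // => e /negbTE ->.
  by rewrite mul0r.
have sum1 : \sum_e (e == f)%:R = 1 :> R.
  by rewrite -[RHS](sumE (fun=> 1)); apply: eq_bigr => e _; rewrite mulr1.
have sum0 (z : cochain1 G R) : \sum_e (e == f)%:R * (0 * z e) = 0.
  by rewrite sumE mul0r.
have := alpha_ge_discrete (fun e => ler0n _ (e == f)) sum1 (s := fun=> 0) c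
  (fun g => sum0 (coboundary g)).
by rewrite sum0 sumE sub0r.
Qed.

Lemma alpha_min_static c f :
  (alpha H c <= (- L f 0)%:E)%E -> alpha H c = min_alpha H.
Proof.
move=> ac; apply/le_anti/andP; split; last by apply: ereal_inf_lbound; exists c.
apply: le_ereal_inf_tmp => _ [c' _ <-].
exact: le_trans ac (alpha_ge_static c' f).
Qed.

Lemma action_integrable mu : (action H mu < +oo)%E ->
  mu.-integrable setT (EFin \o lagrangian H) /\
  action H mu = (\int[mu]_x lagrangian H x)%:E.
Proof.
move=> Ay; have [C LC] := twisted_lagrangian_lb H_ham 0.
have iL : mu.-integrable setT (EFin \o lagrangian H).
  rewrite twisted_lagrangian0 in LC.
  exact: bounded_below_integrable (measurable_lagrangian H_ham) LC Ay.
by split=> //; rewrite /Rintegral fineK //; exact: integrable_fin_num.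
Qed.

Lemma measures_rot_integrable h mu : homology1 h -> measures_rot H h mu ->
  mu.-integrable setT (EFin \o lagrangian H) /\
  beta H h = (\int[mu]_x lagrangian H x)%:E.
Proof.
move=> h0 [_ _ Ah]; rewrite -Ah; apply: action_integrable.
by rewrite Ah beta_lty.
Qed.

Lemma measures_coh_integrable c mu : measures_coh H c mu ->
  mu.-integrable setT (EFin \o lagrangian H) /\
  alpha H c = (pairing (cohom_repr c) (rho mu) - \int[mu]_x lagrangian H x)%:E.
Proof.
move=> [[fm _] muc]; have [C LC] := twisted_lagrangian_lb H_ham (cohom_repr c).
have mT := measurable_twisted_lagrangian H_ham (cohom_repr c).
have iP := integrable_momentum (cohom_repr c) fm.
have iT : mu.-integrable setT (EFin \o twisted_lagrangian H (cohom_repr c)).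
  apply: bounded_below_integrable mT LC _; rewrite -/(twisted_action H _ mu) muc.
  (* The bound at an arbitrary edge excludes the value [-oo] of [alpha H c], so the twisted action
     is not [+oo]. *)
  have := alpha_ge_static c (enum_val (Ordinal (edge_gt0 G))).
  by case: (alpha H c) => //= r; rewrite ltry.
have iL : mu.-integrable setT (EFin \o lagrangian H).
  have := integrable_EFinD iT iP; congr (integrable _ _ _).
  by apply/funext => x /=; rewrite twisted_lagrangianE subrK.
split=> //; rewrite -[LHS]oppeK -muc pairing_rhoE // -opprB EFinN.
congr (- _)%E; rewrite -RintegralB // /Rintegral fineK //.
exact: integrable_fin_num iT.
Qed.

Section static.
Variables mu1 mu2 : bprob.
Hypotheses (fm1 : finite_moment_measures mu1) (fm2 : finite_moment_measures mu2).
Hypothesis L1 : mu1.-integrable setT (EFin \o lagrangian H).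
Hypothesis L2 : mu2.-integrable setT (EFin \o lagrangian H).
(** Each of the two measures has line masses adding up to 2 over the oriented edges, hence the
    divisor 4. *)
Local Notation w := (fun e => (line_mass mu1 e + line_mass mu2 e) / 4).
Local Notation s := (mean_speed mu1 mu2).

Lemma mean_weight_ge0 e : 0 <= w e.
Proof. by rewrite divr_ge0 // addr_ge0 // line_mass_ge0. Qed.

Lemma mean_weight_sum : \sum_e w e = 1.
Proof. by rewrite -mulr_suml big_split /= !sum_line_mass; field. Qed.

Lemma mean_weight_pairing (z : cochain1 G R) : \sum_e w e * (s e * z e) =
  2^-1 * (pairing z (rho mu1) + pairing z (rho mu2)).
Proof.
rewrite !pairing_rho // -mulrDr -big_split mulrA mulr_sumr /=.
by apply: eq_bigr => e _; rewrite -mulrDl -(mean_speedE mu1 mu2 e); field.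
Qed.

Lemma mean_weight_action : mean_action H mu1 mu2 = 2 * \sum_e w e * L e (s e).
Proof. by rewrite /mean_action !mulr_sumr; apply: eq_bigr => e _; field. Qed.

End static.

(** If no discrete competitor with the averaged rotation vector beats the average action, then the
    concentrated average does not either, and Jensen's inequality is an equality. *)
Lemma minimizers_static mu1 mu2 :
  finite_moment_measures mu1 -> finite_moment_measures mu2 ->
  mu1.-integrable setT (EFin \o lagrangian H) ->
  mu2.-integrable setT (EFin \o lagrangian H) ->
  (forall w s : edge G -> R, (forall e, 0 <= w e) -> \sum_e w e = 1 ->
    (forall z : cochain1 G R, \sum_e w e * (s e * z e) =
      2^-1 * (pairing z (rho mu1) + pairing z (rho mu2))) ->
    \int[mu1]_x lagrangian H x + \int[mu2]_x lagrangian H x <=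
      2 * \sum_e w e * L e (s e)) ->
  exists s : edge G -> R, forall f x, msupport mu1 x \/ msupport mu2 x ->
    in_line f x -> sspeed f x = s f.
Proof.
move=> fm1 fm2 L1 L2 min12; exists (mean_speed mu1 mu2).
apply: (mean_action_support H_ham fm1 fm2 L1 L2); rewrite mean_weight_action.
apply: min12; first exact: mean_weight_ge0.
  exact: mean_weight_sum.
exact: mean_weight_pairing.
Qed.

Lemma line_mass_gt0 mu f x : msupport mu x -> in_line f x -> 0 < line_mass mu f.
Proof.
move=> xmu xf; have := xmu _ (@open_line G R f) xf.
have -> : mu [set y | in_line f y] = (line_mass mu f)%:E.
  have mU : measurable ([set y | in_line f y] : set (tborel G R)).
    by apply: sub_sigma_algebra; exact: open_line.
  rewrite /line_mass /Rintegral fineK; last first.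
    exact: integrable_fin_num (integrable_line_ind mu f).
  rewrite -[in LHS](setIT [set y | in_line f y]) -integral_indic //.
  apply: eq_integral => y _; congr EFin; rewrite indicE /line_ind; congr (_%:R).
  by congr nat_of_bool; apply/idP/idP; rewrite inE.
by rewrite lte_fin.
Qed.

(** Minimality enters as an upper bound on [alpha H c], a form that both kinds of minimizers can
    supply. *)
Lemma alpha_min_support mu c f (q : {nonneg R}) : closed_measures mu ->
  mu.-integrable setT (EFin \o lagrangian H) ->
  (alpha H c <=
    (pairing (cohom_repr c) (rho mu) - \int[mu]_x lagrangian H x)%:E)%E ->
  msupport mu (tpoint f q) -> q%:num = 0 -> alpha H c = min_alpha H.
Proof.
move=> [fm cl] iL ac xmu q0; apply: (@alpha_min_static c f).
apply: (le_trans ac); rewrite lee_fin.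
set A := \int[mu]_x _; set P := pairing _ _.
have xf : in_line f (tpoint f q : tangent G R) by rewrite in_line_tpoint eqxx.
pose w e := (line_mass mu e + line_mass mu e) / 4.
pose s := mean_speed mu mu.
have w0 e : 0 <= w e by exact: mean_weight_ge0.
have w1 : \sum_e w e = 1 by exact: mean_weight_sum.
have ws (z : cochain1 G R) : \sum_e w e * (s e * z e) = pairing z (rho mu).
  by rewrite mean_weight_pairing //; field.
have mean_le : \sum_e w e * L e (s e) <= A.
  have := mean_action_le H_ham fm fm iL iL.
  by rewrite mean_weight_action -/A => ?; rewrite /w /s; lra.
(* Competitors at the same speeds [s] whose rotation vector is [k] times that of [mu]; used with
   [k = 1] and with [k = 1 + w f]. *)
have closed_ge (v : edge G -> R) (k : R) : (forall e, 0 <= v e) ->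
    \sum_e v e = 1 ->
    (forall z : cochain1 G R,
      \sum_e v e * (s e * z e) = k * pairing z (rho mu)) ->
    k * P - \sum_e v e * L e (s e) <= P - A.
  move=> v0 v1 vs; rewrite -lee_fin; apply: le_trans ac.
  rewrite /P -vs; apply: alpha_ge_discrete => // g.
  by rewrite vs [pairing _ _](cl g) mulr0.
(* The support point at the origin must sit at the mean speed of its line. *)
have sf : s f = 0.
  rewrite -q0 -(sspeed_tpoint f q); apply/esym.
  apply: (mean_action_support H_ham fm fm iL iL) xf; last by left.
  rewrite mean_weight_action -/A.
  have := @closed_ge w 1 w0 w1; rewrite mul1r => /(_ _) H1.
  have {}H1 := H1 (fun z => etrans (ws z) (esym (mul1r _))).
  by move: H1; rewrite /w /s; lra.
have t0 : 0 < w f.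
  by have := line_mass_gt0 xmu xf; rewrite /w; lra.
(* Removing mass from the equilibrium at the origin of the line of [f] and
   rescaling yields a competitor with a proportional rotation vector. *)
pose v e := (1 + w f) * w e - w f * (e == f)%:R.
have sumv (F : edge G -> R) :
    \sum_e v e * F e = (1 + w f) * \sum_e w e * F e - w f * F f.
  rewrite mulr_sumr; have -> : w f * F f = \sum_e w f * (e == f)%:R * F e.
    rewrite (bigD1 f) //= eqxx mulr1 big1 ?addr0 // => e /negbTE ->.
    by rewrite mulr0 mul0r.
  by rewrite -sumrB; apply: eq_bigr => e _; rewrite /v; ring.
(* With [w f] as the amount removed, the weight left at [f] is [w f * w f]. *)
have v0 e : 0 <= v e.
  rewrite /v; have [->|_] := eqVneq e f; last first.
    by rewrite mulr0 subr0 mulr_ge0 // addr_ge0.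
  by rewrite mulr1 mulrDl mul1r addrAC subrr add0r mulr_ge0.
have v1 : \sum_e v e = 1.
  have := sumv (fun=> 1); under eq_bigr do rewrite mulr1.
  by move=> ->; under eq_bigr do rewrite mulr1; rewrite w1; ring.
have vs (z : cochain1 G R) : \sum_e v e * (s e * z e) = (1 + w f) * pairing z (rho mu).
  by rewrite sumv sf mul0r mulr0 subr0 ws.
have := closed_ge v _ v0 v1 vs; rewrite sumv sf => vge.
(* Bounding the action of the concentrated measure by [A] in [vge] leaves this inequality, to be
   divided by [w f]. *)
suff : w f * L f 0 <= w f * (A - P) by rewrite ler_pM2l //; lra.
have : (1 + w f) * (\sum_e w e * L e (s e)) <= (1 + w f) * A.
  by rewrite ler_wpM2l // addr_ge0.
lra.
Qed.

Lemma measures_coh_static c mu1 mu2 : measures_coh H c mu1 -> measures_coh H c mu2 ->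
  exists s : edge G -> R, forall f x, msupport mu1 x \/ msupport mu2 x ->
    in_line f x -> sspeed f x = s f.
Proof.
move=> c1 c2; have [iL1 ac1] := measures_coh_integrable c1.
have [iL2 ac2] := measures_coh_integrable c2.
case: c1 c2 => [[fm1 cl1] _] [[fm2 cl2] _].
apply: minimizers_static => // w s w0 w1 ws.
have := alpha_ge_discrete w0 w1 (s := s) c.
rewrite ws ac1 lee_fin => /(_ _)-le1; move: ac2; rewrite ac1 => -[].
have := le1 _; set P1 := pairing _ _; set P2 := pairing _ _ => {}le1 E.
(* Both measures realize the same [alpha H c], so [E] converts this bound into the symmetric one. *)
suff : 2^-1 * (P1 + P2) - \sum_e w e * L e (s e) <=
    P1 - \int[mu1]_x lagrangian H x by lra.
apply: le1 => g; rewrite ws.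
have := cl1 g; have := cl2 g; rewrite /int_cochain => -> ->.
by rewrite addr0 mulr0.
Qed.

Lemma measures_rot_static h mu1 mu2 : homology1 h ->
  measures_rot H h mu1 -> measures_rot H h mu2 ->
  exists s : edge G -> R, forall f x, msupport mu1 x \/ msupport mu2 x ->
    in_line f x -> sspeed f x = s f.
Proof.
move=> h0 h1 h2; have [iL1 b1] := measures_rot_integrable h0 h1.
have [iL2 b2] := measures_rot_integrable h0 h2.
case: h1 h2 => [[fm1 _] rho1 _] [[fm2 _] rho2 _].
apply: minimizers_static => // w s w0 w1 ws.
have : (beta H h <= (\sum_e w e * L e (s e))%:E)%E.
  by apply: beta_le_discrete => // z; rewrite ws rho1 rho2; field.
move: b2; rewrite b1 lee_fin => -[]; lra.
Qed.

(** For a subgradient [c] of [beta] at [h], the supremum defining [alpha H c] is reached at [h]. *)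
Lemma in_subdifferential_alpha_le h c mu : homology1 h -> measures_rot H h mu ->
  in_subdifferential_beta H h c ->
  (alpha H c <=
    (pairing (cohom_repr c) (rho mu) - \int[mu]_x lagrangian H x)%:E)%E.
Proof.
move=> h0 hmu sub; have [_ bh] := measures_rot_integrable h0 hmu.
case: hmu => _ -> _; apply: ge_ereal_sup => _ [h' h'0 <-].
(* The subgradient inequality excludes [beta H h' = -oo], while [+oo] contributes [-oo] to the
   supremum. *)
have := sub h' h'0; rewrite bh; case: (beta H h') => [b| |] //=.
- by rewrite -EFinD -EFinB !lee_fin /pairing_cohom; lra.
- by rewrite leNye.
Qed.

Lemma tpoint_eq (s : edge G -> R) f (q1 q2 : {nonneg R}) :
  sspeed f (tpoint f q1 : tangent G R) = s f ->
  sspeed f (tpoint f q2 : tangent G R) = s f -> q1 = q2.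
Proof. by rewrite !sspeed_tpoint => <- /esym q12; apply/val_inj. Qed.

Lemma tpoint_opposite_eq (s : edge G -> R) f (q1 q2 : {nonneg R}) :
  sspeed f (tpoint f q1 : tangent G R) = s f ->
  sspeed f (tpoint (opposite f) q2 : tangent G R) = s f ->
  q1%:num = 0 /\ q2%:num = 0.
Proof.
rewrite sspeed_tpoint sspeed_tpoint_opposite => <-.
by have : 0 <= q1%:num by []; have : 0 <= q2%:num by []; split; lra.
Qed.

End mather_theory.

Theorem proposition6p2 (R : realType) (G : graph)
    (G_connected : graph_connected G) (G_loopless : loopless G)
    (H : edge G -> R -> R) (H_ham : hamiltonian H)
    (c : cohomology1 G R) (h : chain1 G R) (h_cycle : homology1 h) :
  (forall (f : edge G) (q1 q2 : {nonneg R}),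
      (mather_coh H c (tpoint f q1) -> mather_coh H c (tpoint f q2) ->
       q1 = q2) /\
      (mather_rot H h (tpoint f q1) -> mather_rot H h (tpoint f q2) ->
       q1 = q2)) /\
  (forall (f : edge G) (q1 q2 : {nonneg R}),
      (mather_coh H c (tpoint f q1) -> mather_coh H c (tpoint (opposite f) q2) ->
       [/\ q1%:num = 0, q2%:num = 0 & alpha H c = min_alpha H]) /\
      (mather_rot H h (tpoint f q1) -> mather_rot H h (tpoint (opposite f) q2) ->
       [/\ q1%:num = 0, q2%:num = 0 &
           in_subdifferential_beta H h c -> alpha H c = min_alpha H])).
Proof.
have line1 f q : in_line f (tpoint f q : tangent G R).
  by rewrite in_line_tpoint eqxx.
have line2 f q : in_line f (tpoint (opposite f) q : tangent G R).
  by rewrite in_line_tpoint eqxx orbT.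
split=> f q1 q2; split=> -[mu1 m1 x1] [mu2 m2 x2].
- have [s sP] := measures_coh_static H_ham m1 m2.
  by apply: (@tpoint_eq _ _ s f); apply: sP => //; [left|right].
- have [s sP] := measures_rot_static H_ham h_cycle m1 m2.
  by apply: (@tpoint_eq _ _ s f); apply: sP => //; [left|right].
- have [s sP] := measures_coh_static H_ham m1 m2.
  have [||q10 q20] := @tpoint_opposite_eq _ _ s f q1 q2.
  + by apply: sP => //; left.
  + by apply: sP => //; right.
  have [iL ac] := measures_coh_integrable H_ham m1.
  split=> //; apply: (alpha_min_support H_ham m1.1 iL _ x1 q10).
  by rewrite ac.
- have [s sP] := measures_rot_static H_ham h_cycle m1 m2.
  have [||q10 q20] := @tpoint_opposite_eq _ _ s f q1 q2.
  + by apply: sP => //; left.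
  + by apply: sP => //; right.
  split=> // sub; have [iL _] := measures_rot_integrable H_ham h_cycle m1.
  have ac := in_subdifferential_alpha_le H_ham h_cycle m1 sub.
  by case: m1 => cl _ _; apply: (alpha_min_support H_ham cl iL ac x1 q10).
Qed.
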